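(* Let $C \subseteq [0,1]^n$ be compact and convex and let $\langle c, x \rangle \leq \gamma$ be valid for $C\cap \mathbb{Z}^n$. There exist a branch-and-bound proof and a cutting plane proof, both based on variable disjunctions (with respect to $C\cap\mathbb{Z}^n$), that prove the validity of this inequality and whose size is bounded by a function only of the dimension $n$. Thus, for instances in a fixed dimension, there are $O(1)$ size branch-and-bound and cutting plane proofs.
   Context: A valid disjunction for a closed set $S\subseteq\mathbb{R}^n$ (here $S=\mathbb{Z}^n$) is a finite union $D=Q_1\cup\dots\cup Q_k$ of closed convex sets with $S\subseteq D$. The family $\mathcal{D}$ of variable disjunctions consists of $D_{i,K}=\{x\in\mathbb{R}^n: x_i\le K\}\cup\{x\in\mathbb{R}^n: x_i\ge K+1\}$, $i\in\{1,\dots,n\}$, $K\in\mathbb{Z}$. A cutting plane for a convex set $C$ derived from $D$ is a halfspace $H$ with $C\cap D\subseteq H$. A cutting plane proof based on $\mathcal{D}$ with respect to $C\cap S$ of length (size) $N$ for an inequality $\langle c,x\rangle\le\gamma$ valid for $C\cap S$ is a sequence of halfspaces $H_1,\dots,H_N$ for which there are $D_1,\dots,D_N\in\mathcal{D}$ such that for each $i=0,\dots,N-1$, $H_{i+1}$ is a cutting plane derived from $D_{i+1}$ for $C_i:=C\cap\bigcap_{j=1}^{i}H_j$ (with $C_0=C$), and $\langle c,x\rangle\le\gamma$ is valid for all points of $C_N$. A branch-and-bound proof based on $\mathcal{D}$ of such an inequality is a rooted tree whose nodes represent convex subsets of $C$, whose root represents $C$, such that for each non-leaf node representing $C'$ there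 is $D=Q_1\cup\dots\cup Q_k\in\mathcal{D}$ so that its children represent $C'\cap Q_1,\dots,C'\cap Q_k$, and such that $\langle c,x\rangle\le\gamma$ is valid for all sets represented by leaves. Its size is the number of nodes minus 1. *)

(* Defs.v *)
From HB Require Import structures.
From mathcomp Require Import all_boot all_order all_algebra.
From mathcomp Require Import all_classical all_reals all_analysis.
From mathcomp Require Import lra.

Set Implicit Arguments.
Unset Strict Implicit.
Unset Printing Implicit Defensive.

Import Order.TTheory GRing.Theory Num.Theory.
Import numFieldNormedType.Exports.

Local Open Scope classical_set_scope.
Local Open Scope convex_scope.
Local Open Scope ring_scope.

Section Euclidean.
Variables (R : realType) (n : nat).
Notation V := 'rV[R]_n.

Definition inner (a x : V) : R := \sum_(i < n) a ord0 i * x ord0 i.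

(* The set {x | <a, x> <= b}; the normal [a] is allowed to be zero here, since
   this is also used for arbitrary linear inequalities. *)
Definition lin_ineq (a : V) (b : R) : set V := [set x | inner a x <= b].

Definition is_halfspace (H : set V) : Prop :=
  exists a b, a != 0 /\ H = lin_ineq a b.

Definition valid_ineq (X : set V) (c : V) (gamma : R) : Prop :=
  X `<=` lin_ineq c gamma.

Definition integer_points : set V := [set x | forall i, x ord0 i \is a Num.int].

Definition unit_cube : set V := [set x | forall i, 0 <= x ord0 i <= 1].

(* A disjunction is given by the list of its pieces Q_1, ..., Q_k. *)
Definition disjunction := seq (set V).

Definition pieces_union (D : disjunction) : set V :=
  \big[setU/set0]_(Q <- D) Q.

Definition valid_disjunction (S : set V) (D : disjunction) : Prop :=
  (forall k, (k < size D)%N ->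
     closed (nth set0 D k) /\ convex_set (nth set0 D k)) /\
  S `<=` pieces_union D.

Definition variable_disjunction (i : 'I_n) (K : int) : disjunction :=
  [:: [set x : V | x ord0 i <= K%:~R]; [set x : V | K%:~R + 1 <= x ord0 i]].

Definition variable_disjunctions : set disjunction :=
  [set D | exists i K, D = variable_disjunction i K].

Lemma variable_disjunctions_valid (D : disjunction) :
  variable_disjunctions D -> valid_disjunction integer_points D.
Proof.
have coordE (i : 'I_n) (x y : convex_lmodType V) (l : {i01 R}) :
    (x <| l |> y : V) ord0 i =
    l%:num * (x : V) ord0 i + (1 - l%:num) * (y : V) ord0 i.
  by rewrite /conv/= !mxE.
have l01 (l : {i01 R}) : 0 <= l%:num /\ 0 <= 1 - l%:num.
  by split; rewrite ?subr_ge0.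
move=> [i [K ->]]; split => [[|[|k]]//= _|x xint].
- split.
    apply: (@preimage_closed _ _ (fun x : V => x ord0 i) [set r | r <= K%:~R]).
      by move=> x _; exact: coord_continuous.
    exact: closed_le.
  move=> x y l; rewrite !inE /= coordE => xK yK.
  have [l0 l1] := l01 l; have := ler_wpM2l l0 xK; have := ler_wpM2l l1 yK; lra.
- split.
    apply: (@preimage_closed _ _ (fun x : V => x ord0 i)
      [set r | K%:~R + 1 <= r]).
      by move=> x _; exact: coord_continuous.
    exact: closed_ge.
  move=> x y l; rewrite !inE /= coordE => xK yK.
  have [l0 l1] := l01 l; have := ler_wpM2l l0 xK; have := ler_wpM2l l1 yK; lra.
- rewrite /pieces_union !big_cons big_nil setU0 /=.
  have /intrP[m xm] := xint i; rewrite xm.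
  have [mK|Km] := leP m K; [left|right] => /=.
    by rewrite ler_int.
  by rewrite -[1]/(1%:~R) -intrD ler_int lezD1.
Qed.

Definition cutting_plane (C : set V) (D : disjunction) (H : set V) : Prop :=
  is_halfspace H /\ C `&` pieces_union D `<=` H.

(* [truncation C Hs i] is the intersection of C with the first i members of
   Hs; only indices i <= size Hs are relevant. *)
Definition truncation (C : set V) (Hs : seq (set V)) (i : nat) : set V :=
  C `&` \bigcap_(j < i) nth setT Hs j.

(* The length of the proof is [size Hs]. *)
Definition cutting_plane_proof (DD : set disjunction) (C : set V)
    (c : V) (gamma : R) (Hs : seq (set V)) : Prop :=
  (forall i, (i < size Hs)%N ->
     exists2 D, DD D & cutting_plane (truncation C Hs i) D (nth setT Hs i)) /\
  valid_ineq (truncation C Hs (size Hs)) c gamma.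

(* A node carries the set it represents and its children; leaves are the nodes
   with no children. *)
Inductive bb_tree := BBNode of set V & seq bb_tree.

Definition bb_label (t : bb_tree) : set V := let: BBNode X _ := t in X.

Fixpoint bb_nodes (t : bb_tree) : nat :=
  let: BBNode _ ts := t in (sumn (map bb_nodes ts)).+1.

Definition bb_size (t : bb_tree) : nat := (bb_nodes t).-1.

(* [P X ts] holds at every node, X being its label and ts its children. *)
Fixpoint bb_all (P : set V -> seq bb_tree -> Prop) (t : bb_tree) : Prop :=
  let: BBNode X ts := t in
  P X ts /\ foldr (fun u Q => bb_all P u /\ Q) True ts.

Definition bb_node_ok (DD : set disjunction) (C : set V) (c : V) (gamma : R)
    (X : set V) (ts : seq bb_tree) : Prop :=
  [/\ convex_set X, X `<=` C,
      ts <> [::] ->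
        exists2 D, DD D & map bb_label ts = map (fun Q => X `&` Q) D
    & ts = [::] -> valid_ineq X c gamma].

Definition branch_and_bound_proof (DD : set disjunction) (C : set V)
    (c : V) (gamma : R) (t : bb_tree) : Prop :=
  bb_label t = C /\ bb_all (bb_node_ok DD C c gamma) t.

End Euclidean.

(* Main.v *)
Require Import Defs.
From mathcomp Require Import all_boot all_order all_algebra.
From mathcomp Require Import all_classical all_reals all_analysis.
From mathcomp Require Import lra zify.
Set Implicit Arguments.
Unset Strict Implicit.
Unset Printing Implicit Defensive.

Import Order.TTheory GRing.Theory Num.Theory.
Import numFieldNormedType.Exports.
Local Open Scope classical_set_scope.
Local Open Scope ring_scope.

(** Branch-and-bound: since C lies in the cube, branching on x_i <= 0 or
    x_i >= 1 forces x_i to be 0 or 1, so the full binary tree that branches on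
    every coordinate has only integer points of C at its leaves.  It has
    2 ^ (n + 1) - 1 nodes.

    Cutting planes: simulate that tree from the leaves to the root.  A node
    fixes the coordinates in a set A to the values of some v in {0,1}^n.  The
    l1 distance of x to the face { x_i = v_i, i in A } is
    sum_(i in A) |x_i - v_i|, which is an affine function of x on the cube;
    hence, for a constant M,
                     <c, x> <= gamma + M * dist_(A,v)(x)
    is a linear inequality, which on the face itself says <c, x> <= gamma.

    - At a leaf (A everything, the face is the vertex v) this is valid for C
      once M is large.  If v is in C then <c, v> <= gamma, and the slope of c
      is absorbed by M.  If not, compactness keeps C at a positive distance
      from v, so the right-hand side is large on all of C
      ([near_penalized_vertex]).  There are finitely many vertices, so one M
      serves for all of them.
    - Let i be outside A.  Where x_i = 0, the distance to the face of A
      equals the distance to the subface x_i = 0, and similarly for x_i = 1.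
      So the inequality of A is valid on both pieces of the disjunction on x_i
      as soon as those of the two subfaces are available: it is a single cut
      derived from them, with the same M ([cut_derivable_penalized]).

    At the root A is empty and the inequality is <c, x> <= gamma itself, after
    2 ^ n - 1 cuts.

    A halfspace must have a nonzero normal.  Taking M larger than every |c_i|
    ensures this when c is nonzero; if c = 0 and gamma < 0 then C has no
    integer point, and proving x_0 <= -1 instead shows that nothing
    remains. *)

Lemma pieces_union_variable {R : realType} {n : nat} (i : 'I_n) (K : int) :
  pieces_union (variable_disjunction R i K) =
  [set x | x ord0 i <= K%:~R \/ K%:~R + 1 <= x ord0 i].
Proof. by rewrite /pieces_union !big_cons big_nil setU0. Qed.

(** * Branching on every coordinate *)

Section BranchAndBound.
Context {R : realType} {n : nat}.
Notation V := 'rV[R]_n.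

Fixpoint branch_all (X : set V) (l : seq 'I_n) : bb_tree R n :=
  if l is i :: l' then
    BBNode X [seq branch_all (X `&` Q) l' | Q <- variable_disjunction R i 0]
  else BBNode X [::].

Lemma bb_label_branch_all X l : bb_label (branch_all X l) = X.
Proof. by case: l. Qed.

(** The successor avoids a truncated subtraction on the right. *)
Lemma bb_nodes_branch_all X l :
  (bb_nodes (branch_all X l)).+1 = (2 ^ (size l).+1)%N.
Proof.
elim: l X => [//|i l IH] X /=.
by rewrite addn0 -addSn -addnS !IH addnn -mul2n -expnS.
Qed.

Lemma convex_setI (X Y : set V) :
  convex_set X -> convex_set Y -> convex_set (X `&` Y).
Proof.
move=> cX cY x y l; rewrite !inE => -[xX xY] [yX yY].
by split; apply: set_mem; [apply: cX|apply: cY]; rewrite inE.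
Qed.

(** The coordinates outside [l] are those already branched on, along the path
    from the root to the node labelled [X]; [C] being inside the cube, each
    piece of the disjunction pins its coordinate to 0 or 1. *)
Lemma bb_all_branch_all (C X : set V) c gamma l :
  convex_set X -> X `<=` C -> C `<=` @unit_cube R n ->
  valid_ineq (C `&` @integer_points R n) c gamma ->
  (forall x i, X x -> i \notin l -> x ord0 i \is a Num.int) ->
  bb_all (bb_node_ok (@variable_disjunctions R n) C c gamma) (branch_all X l).
Proof.
move=> + + Ccube Cvalid; elim: l X => [|i l IH] X cX XC Xint /=.
  split=> //; split=> // _ x Xx; apply: Cvalid; split; first exact: XC.
  by move=> i; apply: Xint.
have [pieces_ok _] :
    valid_disjunction (@integer_points R n) (variable_disjunction R i 0).
  by apply: variable_disjunctions_valid; exists i, 0.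
have [_ conv0] := pieces_ok 0%N isT; have [_ conv1] := pieces_ok 1%N isT.
have child (Q : set V) : convex_set Q ->
    (forall x, C x -> Q x -> x ord0 i \is a Num.int) ->
    bb_all (bb_node_ok (@variable_disjunctions R n) C c gamma)
      (branch_all (X `&` Q) l).
  move=> cQ Qint; apply: IH; first exact: convex_setI.
    by move=> x [/XC].
  move=> x j [Xx Qx] jl; have [->|ji] := eqVneq j i.
    exact: (Qint _ (XC _ Xx)).
  by apply: Xint; rewrite // inE negb_or ji.
split.
  split=> // _; exists (variable_disjunction R i 0); first by exists i, 0.
  by rewrite /= !bb_label_branch_all.
split; [|split=> //]; [apply: (child _ conv0)|apply: (child _ conv1)].
  move=> x Cx /= xi; have /andP[x0 _] := Ccube x Cx i.
  by rewrite (_ : x ord0 i = 0) //; lra.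
move=> x Cx /= xi; have /andP[_ x1] := Ccube x Cx i.
by rewrite (_ : x ord0 i = 1) //; lra.
Qed.

End BranchAndBound.

(** * Composition of cutting plane derivations *)

Section CutDerivations.
Context {R : realType} {n : nat} (DD : set (disjunction R n)).
Notation V := 'rV[R]_n.
Variable C : set V.

Definition cuts_sound (Hs : seq (set V)) : Prop :=
  forall i, (i < size Hs)%N ->
    exists2 D, DD D & cutting_plane (truncation C Hs i) D (nth setT Hs i).

(** Derivability of a set rather than of an inequality, with a bound on the
    length: this forgets the cuts themselves, so that derivations can be
    combined without tracking indices in the list. *)
Definition cut_derivable (X : set V) (m : nat) : Prop :=
  exists Hs, [/\ cuts_sound Hs, (size Hs <= m)%N &
    truncation C Hs (size Hs) `<=` X].

Lemma cutting_planeS (X Y : set V) D H :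
  X `<=` Y -> cutting_plane Y D H -> cutting_plane X D H.
Proof. by move=> XY [hH YH]; split=> // x [/XY ? ?]; apply: YH. Qed.

Lemma truncation_cat_le Hs Gs i : (i <= size Hs)%N ->
  truncation C (Hs ++ Gs) i = truncation C Hs i.
Proof.
move=> iHs; congr (_ `&` _); apply: eq_bigcapr => j /= ji.
by rewrite nth_cat (leq_trans ji iHs).
Qed.

Lemma truncation_cat_ge Hs Gs i :
  truncation C (Hs ++ Gs) (size Hs + i) `<=` truncation C Gs i.
Proof.
move=> x [Cx cutx]; split=> // j /= ji; have := cutx (size Hs + j)%N.
by rewrite /= ltn_add2l nth_cat ifN ?addKn -?leqNgt ?leq_addr //; apply.
Qed.

Lemma cuts_sound_cat Hs Gs :
  cuts_sound Hs -> cuts_sound Gs -> cuts_sound (Hs ++ Gs).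
Proof.
move=> sH sG i; rewrite size_cat nth_cat; have [iH _|Hi] := ltnP i (size Hs).
  have [D DD_D cutD] := sH i iH; exists D => //.
  by rewrite truncation_cat_le // ltnW.
move=> iHG; have /sG[D DD_D cutD] : (i - size Hs < size Gs)%N by lia.
exists D => //; apply: cutting_planeS cutD; rewrite -{1}(subnKC Hi).
exact: truncation_cat_ge.
Qed.

Lemma cut_derivableW {X Y : set V} {m p} :
  cut_derivable X m -> C `&` X `<=` Y -> (m <= p)%N -> cut_derivable Y p.
Proof.
move=> [Hs [sH szH HX]] XY mp; exists Hs; split=> //; first exact: leq_trans mp.
by move=> x xH; apply: XY; split; [case: xH | exact: HX].
Qed.

Lemma cut_derivable_initial : cut_derivable C 0.
Proof. by exists [::]; split=> // x []. Qed.

(** Concatenation works because a cut stays a cut for a smaller set: the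
    cuts of the second derivation are now applied to a truncation that has
    also been cut by the first. *)
Lemma cut_derivableI {X Y : set V} {m p} :
  cut_derivable X m -> cut_derivable Y p -> cut_derivable (X `&` Y) (m + p).
Proof.
move=> [Hs [sH szH HX]] [Gs [sG szG GY]]; exists (Hs ++ Gs); split.
- exact: cuts_sound_cat.
- by rewrite size_cat leq_add.
- move=> x; rewrite size_cat => xHG; split; last first.
    by apply: GY; apply: truncation_cat_ge xHG.
  apply: HX; rewrite -(truncation_cat_le Gs) //.
  case: xHG => Cx cutx; split=> // j /= jH; apply: cutx => /=.
  exact: leq_trans jH (leq_addr _ _).
Qed.

Lemma cut_derivable_cut {X H : set V} {D m} :
  cut_derivable X m -> DD D -> cutting_plane (C `&` X) D H ->
  cut_derivable H m.+1.
Proof.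
move=> [Hs [sH szH HX]] DD_D cutH; exists (Hs ++ [:: H]); split.
- move=> i; rewrite size_cat addn1 ltnS leq_eqVlt => /orP[/eqP ->|iH].
    exists D => //; rewrite nth_cat ltnn subnn truncation_cat_le //.
    apply: cutting_planeS cutH => x xH; split; last exact: HX.
    by case: xH.
  rewrite nth_cat iH truncation_cat_le ?(ltnW iH) //; exact: sH.
- by rewrite size_cat addn1.
- move=> x [_ /(_ (size Hs))]; rewrite size_cat addn1 nth_cat ltnn subnn.
  by apply => /=.
Qed.

End CutDerivations.

(** * Penalized inequalities on the faces of the cube *)

Section Cube.
Context {R : realType} {n : nat}.
Notation V := 'rV[R]_n.
Notation vertex := {ffun 'I_n -> bool}.

(** The affine function of t which equals |t - b| on [0, 1]. *)
Definition coord_dist (b : bool) (t : R) : R := if b then 1 - t else t.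

Definition face_dist (A : {set 'I_n}) (v : vertex) (x : V) : R :=
  \sum_(i in A) coord_dist (v i) (x ord0 i).

Definition set_coord (v : vertex) (i : 'I_n) (b : bool) : vertex :=
  [ffun j => if j == i then b else v j].

Definition penalized_ineq c gamma (M : R) A v : set V :=
  [set x | inner c x <= gamma + M * face_dist A v x].

Lemma face_dist_set_coord (A : {set 'I_n}) v (x : V) i b : i \notin A ->
  face_dist (i |: A) (set_coord v i b) x =
  coord_dist b (x ord0 i) + face_dist A v x.
Proof.
move=> iA; rewrite /face_dist big_setU1 //= ffunE eqxx; congr (_ + _).
apply: eq_bigr => j jA; rewrite ffunE; case: eqP => // ji.
by rewrite -ji jA in iA.
Qed.

Lemma coord_dist_norm (v : bool) (t : R) : 0 <= t <= 1 ->
  coord_dist v t = `|t - v%:R|.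
Proof.
case: v => /andP[t0 t1] /=; last by rewrite subr0 ger0_norm.
by rewrite distrC ger0_norm ?subr_ge0.
Qed.

(** Coordinate i of the normal is c_i, or c_i - M, or c_i + M; the condition
    on M keeps the last two from vanishing. *)
Lemma is_halfspace_penalized (c : V) (gamma M : R) (A : {set 'I_n}) v :
  c != 0 -> (forall i, `|c ord0 i| < M) ->
  is_halfspace (penalized_ineq c gamma M A v).
Proof.
move=> c0 cM.
pose a : V := \row_i
  (c ord0 i - (if i \in A then M * (if v i then -1 else 1) else 0)).
exists a, (gamma + M * \sum_(i in A) (v i)%:R); split.
  apply: contra_neq c0 => a0; apply/rowP => i.
  move/rowP/(_ i): a0; rewrite !mxE; case: ifPn => _; last by rewrite subr0.
  have := cM i; rewrite ltr_norml => /andP[? ?].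
  by case: (v i) => ?; exfalso; lra.
have innerE x : inner a x =
    inner c x - M * (face_dist A v x - \sum_(i in A) (v i)%:R).
  rewrite /inner /face_dist -sumrB mulr_sumr (big_mkcond (fun i => i \in A)).
  rewrite -sumrB; apply: eq_bigr => i _; rewrite mxE /coord_dist.
  by case: ifP => _; [case: (v i) => /=|]; lra.
by rewrite /penalized_ineq /lin_ineq; apply/seteqP; split=> x /=;
  rewrite innerE; lra.
Qed.

Lemma inner_le_sum_norm (c x : V) : unit_cube x ->
  inner c x <= \sum_i `|c ord0 i|.
Proof.
move=> xcube; apply: ler_sum => i _; have /andP[x0 x1] := xcube i.
apply: le_trans (ler_norm _) _; rewrite normrM (ger0_norm x0).
by rewrite ler_piMr.
Qed.

Definition vertex_point (v : vertex) : V := \row_i (v i)%:R.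

Lemma integer_vertex_point v : integer_points (vertex_point v).
Proof. by move=> i; rewrite mxE; exact: natr_int. Qed.

(** C is closed, hence avoids a ball around the vertex in the sup norm, which
    is dominated by the l1 distance [face_dist]. *)
Lemma vertex_dist_ge (C : set V) v : C `<=` @unit_cube R n -> compact C ->
  ~ C (vertex_point v) ->
  exists2 d : R, 0 < d & forall x, C x -> d <= face_dist [set: 'I_n]%SET v x.
Proof.
move=> Ccube Ccomp vC.
have Cclosed : closed C by apply: compact_closed => //; exact: norm_hausdorff.
have /nbhs_ballP[e /= e0 eC] : nbhs (vertex_point v) (~` C).
  by apply: open_nbhs_nbhs; split=> //; exact: closed_openC.
exists e => // x Cx; rewrite leNgt; apply/negP => xe; apply: (eC x) => //.
split=> // k i; rewrite (ord1 k) -ball_normE /= mxE distrC.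
rewrite -coord_dist_norm; last exact: Ccube.
apply: le_lt_trans xe; rewrite /face_dist (bigD1 i) ?inE //= lerDl.
by apply: sumr_ge0 => j _; rewrite coord_dist_norm //; exact: Ccube.
Qed.

(** The inequality at the leaves.  If the vertex is in C, any M above
    the l1 norm of c works, as <c, x - v> <= |c|_1 * |x - v|_1; otherwise,
    with d > 0 a lower bound on the distance from C to the vertex, it suffices
    that M * d exceeds |c|_1 - gamma, which bounds the violation on the cube. *)
Lemma near_penalized_vertex (C : set V) (c : V) (gamma : R) v :
  C `<=` @unit_cube R n -> compact C ->
  valid_ineq (C `&` @integer_points R n) c gamma ->
  \forall M \near +oo, C `<=` penalized_ineq c gamma M [set: 'I_n]%SET v.
Proof.
move=> Ccube Ccomp Cvalid; set L := \sum_i `|c ord0 i|.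
have [vC|/(vertex_dist_ge Ccube Ccomp)[d d0 dC]] :=
  pselect (C (vertex_point v)).
  apply: filterS (nbhs_pinfty_ge (num_real L)) => M LM x Cx.
  apply: (@le_trans _ _
    (inner c (vertex_point v) + M * face_dist [set: 'I_n]%SET v x)).
    rewrite -lerBlDl /inner -sumrB /face_dist mulr_sumr.
    under [leRHS]eq_bigl do rewrite inE.
    apply: ler_sum => i _; rewrite mxE -mulrBr.
    rewrite coord_dist_norm; last exact: Ccube.
    apply: le_trans (ler_norm _) _; rewrite normrM; apply: ler_wpM2r => //.
    by apply: le_trans LM; rewrite /L (bigD1 i) //= lerDl sumr_ge0.
  by rewrite lerD2r; apply: Cvalid; split=> //; exact: integer_vertex_point.
have := nbhs_pinfty_ge (num_real (Num.max 0 ((L - gamma) / d))).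
apply: filterS => M; rewrite ge_max ler_pdivrMr // => /andP[M0 LM] x Cx.
rewrite /penalized_ineq /= -lerBlDl.
apply: le_trans (le_trans LM (ler_wpM2l M0 (dC x Cx))).
by rewrite lerD2r; apply: inner_le_sum_norm; exact: Ccube.
Qed.

(** The simulation of the tree below the node (A, v).  Fixing one more
    coordinate i to 0 and to 1 gives two inequalities that both reduce, on the
    corresponding piece of the disjunction on x_i, to the inequality of
    (A, v); so that one is a cut, and the cost T satisfies
    T(k + 1) = 2 T(k) + 1 for k free coordinates. *)
Lemma cut_derivable_penalized
    (C : set V) (c : V) (gamma M : R) (A : {set 'I_n}) v :
  C `<=` @unit_cube R n -> c != 0 -> (forall i, `|c ord0 i| < M) ->
  (forall w, C `<=` penalized_ineq c gamma M [set: 'I_n]%SET w) ->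
  cut_derivable (@variable_disjunctions R n) C (penalized_ineq c gamma M A v)
    (2 ^ #|~: A|).-1.
Proof.
move=> Ccube c0 cM leaf; have [m Am] := ubnP #|~: A|.
elim: m A v Am => [//|m IH] A v Am.
have [Afull|[i]] := set_0Vmem (~: A).
  (* Every coordinate is fixed: the inequality already holds on C. *)
  apply: cut_derivableW (@cut_derivable_initial _ _ _ _) _ (leq0n _).
  by rewrite -[A]finset.setCK Afull finset.setC0 => x [Cx _]; apply: leaf.
rewrite inE => iA.
have cardA : #|~: A| = #|~: (i |: A)|.+1.
  by rewrite (cardsD1 i) inE iA finset.setCU finset.setIC -finset.setDE.
have ltm : (#|~: (i |: A)| < m)%N by rewrite -ltnS -cardA.
have := cut_derivable_cut
  (cut_derivableI (IH _ (set_coord v i false) ltm)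
     (IH _ (set_coord v i true) ltm)).
move=> /(_ (penalized_ineq c gamma M A v) (variable_disjunction R i 0)).
have -> : ((2 ^ #|~: A|).-1 =
    ((2 ^ #|~: (i |: A)|).-1 + (2 ^ #|~: (i |: A)|).-1).+1)%N.
  by rewrite cardA expnS; have := expn_gt0 2 #|~: (i |: A)|; lia.
apply; first by exists i, 0.
split; first exact: is_halfspace_penalized.
move=> x [[Cx [/= le0 le1]]]; rewrite pieces_union_variable /= => xi.
move: le0 le1; rewrite /penalized_ineq /= !face_dist_set_coord // /coord_dist.
have /andP[x0 x1] := Ccube x Cx i.
case: xi => xi le0 le1.
  by have x_0 : x ord0 i = 0 by [lra]; rewrite x_0 add0r in le0.
by have x_1 : x ord0 i = 1 by [lra]; rewrite x_1 subrr add0r in le1.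
Qed.

End Cube.

(** * Size bounds *)

Section Bounds.
Context {R : realType} {n : nat}.
Variable C : set 'rV[R]_n.
Hypotheses (Ccube : C `<=` @unit_cube R n).

Lemma branch_and_bound_bound c gamma : convex_set C ->
  valid_ineq (C `&` @integer_points R n) c gamma ->
  exists t : bb_tree R n,
    branch_and_bound_proof (@variable_disjunctions R n) C c gamma t /\
    (bb_size t <= 2 ^ n.+1)%N.
Proof.
move=> Cconv Cvalid; exists (branch_all C (enum 'I_n)); split.
  split; first exact: bb_label_branch_all.
  by apply: bb_all_branch_all => // x i; rewrite mem_enum.
have := bb_nodes_branch_all C (enum 'I_n); rewrite size_enum_ord /bb_size; lia.
Qed.

Lemma cut_derivable_nonzero (c : 'rV[R]_n) (gamma : R) : compact C -> c != 0 ->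
  valid_ineq (C `&` @integer_points R n) c gamma ->
  cut_derivable (@variable_disjunctions R n) C (lin_ineq c gamma) (2 ^ n).
Proof.
move=> Ccomp c0 Cvalid.
have large : \forall M \near +oo, forall i, `|c ord0 i| < M.
  by apply: filter_forall => i; apply: nbhs_pinfty_gt; exact: num_real.
have : \forall M \near +oo, forall w,
    C `<=` penalized_ineq c gamma M [set: 'I_n]%SET w.
  by apply: filter_forall => w; exact: near_penalized_vertex.
move/(filterI large) => /filter_ex[M [cM leaf]].
have := cut_derivable_penalized finset.set0 [ffun=> false] Ccube c0 cM leaf.
rewrite finset.setC0 cardsT card_ord => /cut_derivableW.
apply; last exact: leq_pred.
by move=> x [_]; rewrite /penalized_ineq /face_dist /= big_set0 mulr0 addr0.
Qed.

(** The normal c = 0 cannot be that of a cut.  If moreover gamma < 0, then C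
    contains no integer point, so that x_0 <= -1 is valid for its integer
    points too; deriving it empties C. *)
Lemma cut_derivable_valid (c : 'rV[R]_n) (gamma : R) : compact C ->
  valid_ineq (C `&` @integer_points R n) c gamma ->
  cut_derivable (@variable_disjunctions R n) C (lin_ineq c gamma) (2 ^ n).
Proof.
move=> Ccomp Cvalid; have [c0|] := eqVneq c 0; last first.
  by move=> c0; exact: cut_derivable_nonzero.
have inner0 x : inner c x = 0.
  by rewrite /inner big1 // => i _; rewrite c0 mxE mul0r.
have [g0|g0] := leP 0 gamma.
  apply: cut_derivableW (@cut_derivable_initial _ _ _ _) _ (leq0n _) => x _.
  by rewrite /lin_ineq /= inner0.
have noint x : C x -> ~ integer_points x.
  move=> Cx xint; have := Cvalid x (conj Cx xint).
  by rewrite /lin_ineq /= inner0 leNgt g0.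
case: (posnP n) => [n0|n_gt0].
  (* In dimension 0 every point is integral, so C is already empty. *)
  apply: cut_derivableW (@cut_derivable_initial _ _ _ _) _ (leq0n _).
  move=> x [Cx _].
  by case: (noint x Cx) => i; have := ltn_ord i; rewrite {2}n0.
pose i0 := Ordinal n_gt0; pose e : 'rV[R]_n := delta_mx ord0 i0.
have innere x : inner e x = x ord0 i0.
  rewrite /inner (bigD1 i0) //= big1 ?addr0 ?mxE ?eqxx ?mul1r // => i ii0.
  by rewrite mxE (negPf ii0) andbF mul0r.
have /cut_derivableW : cut_derivable (@variable_disjunctions R n) C
    (lin_ineq e (-1)) (2 ^ n).
  apply: cut_derivable_nonzero => //.
    apply/eqP => /rowP/(_ i0); rewrite !mxE !eqxx => /eqP.
    by rewrite oner_eq0.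
  by move=> x [Cx /(noint x Cx)].
apply=> // x [/Ccube/(_ i0)/andP[x0 _]].
by rewrite /lin_ineq /= innere; lra.
Qed.

End Bounds.

Theorem theorem2p5 (R : realType) :
  exists f : nat -> nat,
  forall (n : nat) (C : set 'rV[R]_n) (c : 'rV[R]_n) (gamma : R),
    C `<=` @unit_cube R n ->
    compact C ->
    convex_set C ->
    valid_ineq (C `&` @integer_points R n) c gamma ->
    (exists t : bb_tree R n,
       branch_and_bound_proof (@variable_disjunctions R n) C c gamma t /\
       (bb_size t <= f n)%N) /\
    (exists Hs : seq (set 'rV[R]_n),
       cutting_plane_proof (@variable_disjunctions R n) C c gamma Hs /\
       (size Hs <= f n)%N).
Proof.
exists (fun n => 2 ^ n.+1)%N => n C c gamma Ccube Ccomp Cconv Cvalid; split.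
  exact: branch_and_bound_bound.
have [Hs [sH szH HC]] := cut_derivable_valid Ccube Ccomp Cvalid.
by exists Hs; split=> //; apply: leq_trans szH _; rewrite leq_exp2l.
Qed.
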